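(* In the setting described in the context, assume: (1) ($S$-fullness) there is $w\in K^*$ such that $b=h\cdot w=\sum_jh_jw_j$ satisfies $b_i>0$ on $S_i$ for all $i=1,\dots,m$; (2) (dual attainment) the dual problem $\sup\{t\cdot v:\ f-h\cdot v\in\mathcal C_+,\ v\in-K^*\}$ attains its supremum; (3) (Archimedean condition) for every $i$, $\mathcal Q(g_i)$ contains a polynomial $R_i^2-(X_1^2+\cdots+X_{n_i}^2)$ with $R_i\in\mathbb R_+$; (4) the problem $\mathfrak p^*=\inf\{\langle\lambda,f\rangle:\lambda\in\mathcal F\}$ has a unique minimizer $\mu^*\in\mathcal F$. Let $(\lambda_\ell^* )$ be a sequence such that $\lambda^*_\ell$ is a canonical optimizer of the truncated problem $\mathfrak p_\ell^*$. Then $(\lambda_\ell^* )$ converges to $\mu^*$ in the weak$^*$ topology, i.e. $\langle\lambda^*_\ell,p\rangle\to\langle\mu^*,p\rangle$ as $\ell\to\infty$ for every $p\in\mathcal R$.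
   Context: Let $m\ge1$. For $i=1,\dots,m$ let $\mathcal R_i=\mathbb R[X_1,\dots,X_{n_i}]$, $g_i=(g_{i,1},\dots,g_{i,r_i})\in\mathcal R_i^{r_i}$, and let $S_i=\{x\in\mathbb R^{n_i}:g_{i,1}(x)\ge0,\dots,g_{i,r_i}(x)\ge0\}$ be compact. $\mathcal R=\prod_i\mathcal R_i$; $\mathcal C_+=\prod_i\mathcal C_+(S_i)$ is the product of the cones of continuous functions nonnegative on $S_i$. $J$ is a countable set, $f\in\mathcal R$, $h=(h_j)_{j\in J}$ with $h_j=(h_{1,j},\dots,h_{m,j})\in\mathcal R$, $t\in\mathbb R^J$, and $K\subset\mathbb R_+^J$ a closed convex cone in the nonnegative orthant ($\mathbb R^J$ has the product topology). $\mathbb R_0^J$: finitely supported sequences; $K^*=\{v\in\mathbb R_0^J:u\cdot v\ge0\ \forall u\in K\}$, $u\cdot v=\sum_ju_jv_j$, $h\cdot v=\sum_jh_jv_j$. $\mathcal D_i=\mathcal R_i^*$ is the algebraic dual of $\mathcal R_i$ with the weak$^*$ topology (pointwise convergence on polynomials); $\mathcal D=\prod_i\mathcal D_i$ with the product topology; $\langle\lambda,f\rangle=\sum_i\langle\lambda_i,f_i\rangle$ and $\langle\lambda,h\rangle=(\langle\lambda,h_j\rangle)_{j\in J}$. $\Sigma^2_i$: sums of squares in $\mathcal R_i$; $\mathcal Q(g_i)=\Sigma^2_i+\sum_j\Sigma_i^2g_{i,j}$. $\Sigma^2_{i,\ell}$: finite sums of squares of polynomials of degree $\le\lfloor\ell/2\rfloor$;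 $\mathcal Q_\ell(g_i)=\Sigma^2_{i,\ell}+\sum_j\Sigma^2_{i,\ell-\deg g_{i,j}}g_{i,j}$ (terms with $\deg g_{i,j}>\ell$ omitted). $\mathcal L=\prod_i\{\lambda\in\mathcal D_i:\lambda\ge0\text{ on }\mathcal Q(g_i)\}$ and $\mathcal L_\ell=\prod_i\{\lambda\in\mathcal D_i:\lambda\ge0\text{ on }\mathcal Q_\ell(g_i)\}$. (Under the Archimedean condition, $\mathcal L$ is identified with the product of the cones of positive Borel measures on the $S_i$.) $\mathcal F=\{\lambda\in\mathcal L:t-\langle\lambda,h\rangle\in K\}$. Throughout, this problem is assumed to have a feasible solution (given by positive Borel measures on the $S_i$). With $J_\ell=\{j\in J:\deg h_{i,j}\le\ell\ \forall i\}$, $h^\ell=(h_j)_{j\in J_\ell}$, $t^\ell=(t_j)_{j\in J_\ell}$ and $K^\ell\subset\mathbb R^{J_\ell}$ the projection of $K$ onto the coordinates in $J_\ell$, the truncated problem is $\mathfrak p_\ell^*=\inf\{\langle\lambda,f\rangle:\ t^\ell-\langle\lambda,h^\ell\rangle\in K^\ell,\ \lambda\in\mathcal L_\ell\}$. The $\ell$-truncation $\lambda^{(\ell)}$ of $\lambda\in\mathcal D$ agrees (componentwise) with $\lambda$ on polynomials of degree $\le\ell$ and vanishes on all monomials of degree $>\ell$. An optimizer $\lambda_\ell^*$ of $\mathfrak p_\ell^*$ is canonical if $\lambda_\ell^*=(\lambda_\ell^* )^{(\ell)}$. *)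

(* Defs.v *)
From HB Require Import structures.
From mathcomp Require Import all_boot all_order all_algebra.
(* The notations of mpoly clash with those of MathComp-Analysis, hence the
   selective import and the re-declared notation below. *)
From mathcomp Require Import -(notations) mpoly.
From mathcomp Require Import all_classical all_reals all_analysis.

Set Implicit Arguments.
Unset Strict Implicit.
Unset Printing Implicit Defensive.

Import Order.TTheory GRing.Theory Num.Theory.
Import numFieldNormedType.Exports.

Local Open Scope classical_set_scope.
Local Open Scope ring_scope.

Notation "{ 'mpoly' T [ n ] }" := (mpoly n T)
  (at level 0, T, n at level 2, format "{ 'mpoly'  T [ n ] }") : type_scope.

Definition is_minimizer {T} {R : realType} (A : set T) (c : T -> R) (x : T) :=
  A x /\ forall y, A y -> c x <= c y.

Definition is_maximizer {T} {R : realType} (A : set T) (c : T -> R) (x : T) :=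
  A x /\ forall y, A y -> c y <= c x.

Section OneBlock.
Context {R : realType} {n r : nat}.
Implicit Types (p q : {mpoly R[n]}) (g : 'I_r -> {mpoly R[n]}).

(* msize is one more than the total degree, and mpdeg 0 = 0. *)
Definition mpdeg p : nat := (msize p).-1.

Definition peval p (x : 'rV[R]_n) : R := meval (fun k => x ord0 k) p.

Definition basic_semialg g : set 'rV[R]_n :=
  [set x | forall k, 0 <= peval (g k) x].

Definition nonneg_cont (S : set 'rV[R]_n) : set ('rV[R]_n -> R) :=
  [set F : _ -> R | {within S, continuous F} /\ forall x, S x -> 0 <= F x].

Definition sos : set {mpoly R[n]} :=
  [set p | exists s : seq {mpoly R[n]}, p = \sum_(q <- s) q ^+ 2].

Definition sos_trunc (l : nat) : set {mpoly R[n]} :=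
  [set p | exists2 s : seq {mpoly R[n]},
    all (fun q => mpdeg q <= l./2)%N s & p = \sum_(q <- s) q ^+ 2].

Definition qmodule g : set {mpoly R[n]} :=
  [set p | exists s0 (s : 'I_r -> {mpoly R[n]}),
    [/\ sos s0, forall k, sos (s k) & p = s0 + \sum_k s k * g k]].

Definition qmodule_trunc g (l : nat) : set {mpoly R[n]} :=
  [set p | exists s0 (s : 'I_r -> {mpoly R[n]}),
    [/\ sos_trunc l s0,
        forall k, (mpdeg (g k) <= l)%N -> sos_trunc (l - mpdeg (g k)) (s k)
      & p = s0 + \sum_(k | (mpdeg (g k) <= l)%N) s k * g k]].

Definition archimedean g : Prop :=
  exists2 rho : R, 0 <= rho &
    qmodule g (mpolyC n (rho ^+ 2) - \sum_(k < n) mpolyX R (mnm1 k) ^+ 2).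

End OneBlock.

Section InfiniteSequences.
Context {R : realType} {J : countType}.

Definition finsupp_seq : set (J -> R) :=
  [set v | finite_set [set j | v j != 0]].

(* Here and in dotpoly, v is meant to lie in finsupp_seq: the finitely supported sum is 0 by
   convention when the summand has infinite support. *)
Definition dotseq (u v : J -> R) : R := \sum_(j \in [set: J]) u j * v j.

Definition dual_cone (K : set (J -> R)) : set (J -> R) :=
  [set v | finsupp_seq v /\ forall u, K u -> 0 <= dotseq u v].

Definition convex_cone (K : set (J -> R)) : Prop :=
  [/\ K 0,
      forall u v, K u -> K v -> K (u + v)
    & forall (a : R) u, 0 <= a -> K u -> K (fun j => a * u j)].

End InfiniteSequences.

Section Problem.
Context {R : realType} {m : nat} {n r : 'I_m -> nat} {J : countType}.

Definition polys := forall i, {mpoly R[n i]}.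

Definition functionals := forall i, {scalar {mpoly R[n i]}}.

Definition pairing (lam : functionals) (p : polys) : R :=
  \sum_i lam i (p i).

Definition dotpoly (h : J -> polys) (v : J -> R) : polys :=
  fun i => \sum_(j \in [set: J]) v j *: h j i.

Unset Implicit Arguments.
Context (g : forall i, 'I_(r i) -> {mpoly R[n i]}).
Set Implicit Arguments.
Context (f : polys) (h : J -> polys) (t : J -> R) (K : set (J -> R)).

Definition Lcone : set functionals :=
  [set lam | forall i q, qmodule (g i) q -> 0 <= lam i q].

Definition Lcone_trunc (l : nat) : set functionals :=
  [set lam | forall i q, qmodule_trunc (g i) l q -> 0 <= lam i q].

Definition primal_feasible : set functionals :=
  [set lam | Lcone lam /\ K (fun j => t j - pairing lam (h j))].

Definition S_full : Prop :=
  exists2 w, dual_cone K w &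
    forall i x, basic_semialg (g i) x -> 0 < peval (dotpoly h w i) x.

Definition dual_feasible : set (J -> R) :=
  [set v | (forall i, nonneg_cont (basic_semialg (g i))
                        (peval (f i - dotpoly h v i)))
           /\ dual_cone K (- v)].

(* A positive Borel measure on the compact set S_i is encoded as a finite
   measure on the Borel sigma-algebra of R^(n_i) vanishing outside S_i. *)
Definition measure_feasible : Prop :=
  exists nu : forall i,
      {finite_measure set (g_sigma_algebraType (@open 'rV[R]_(n i))) -> \bar R},
    (forall i, nu i (~` basic_semialg (g i)) = 0%E) /\
    K (fun j => t j - \sum_i
         (\int[nu i]_(x in basic_semialg (g i)) peval (h j i) x)%R).

Definition Jtrunc (l : nat) : set J :=
  [set j | forall i, (mpdeg (h j i) <= l)%N].

Definition trunc_feasible (l : nat) : set functionals :=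
  [set lam | Lcone_trunc l lam /\
     (sigL (Jtrunc l) @` K)
       (sigL (Jtrunc l) (fun j => t j - pairing lam (h j)))].

Definition is_truncation (l : nat) (lam lam' : functionals) : Prop :=
  forall i,
    (forall p, (mpdeg p <= l)%N -> lam' i p = lam i p) /\
    (forall a : multinom (n i), (l < mdeg a)%N -> lam' i (mpolyX R a) = 0).

Definition canonical_optimizer (l : nat) (lam : functionals) : Prop :=
  is_minimizer (trunc_feasible l) (fun lam => pairing lam f) lam
  /\ is_truncation l lam lam.

End Problem.

Arguments polys R {m} n.
Arguments functionals R {m} n.

(* Main.v *)
(** Optimizers of the truncated problems are eventually bounded on every polynomial:
    pairing the constraint with [w] bounds [<lambda_l, b>], Putinar's Positivstellensatz
    makes [b_i - e] an element of [Q(g_i)] for some [e > 0], which bounds the masses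
    [lambda_{l,i}(1)], and the Archimedean condition turns this into a bound on each
    [lambda_{l,i}(q)]. Hence [lambda_l] converges along every ultrafilter finer than
    [l -> oo]. The limit is feasible since [K] is closed, and its cost is at most
    [<mu, f>] since [mu] is feasible for every truncation; so it is [mu] by uniqueness.

    Putinar's theorem comes from the fact that a maximal proper quadratic module [N] over
    an Archimedean one satisfies [N \cup -N = A], so that [a |-> sup {k | a - k \in N}] is a
    ring morphism to [R]. *)

Require Import Defs.
From HB Require Import structures.
From mathcomp Require Import all_boot all_order all_algebra.
From mathcomp Require Import -(notations) mpoly.
From mathcomp Require Import all_classical all_reals all_analysis.
From mathcomp Require Import finmap ring lra.

Set Implicit Arguments.
Unset Strict Implicit.
Unset Printing Implicit Defensive.

Import Order.TTheory GRing.Theory Num.Theory.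
Import numFieldNormedType.Exports.

Local Open Scope classical_set_scope.
Local Open Scope ring_scope.

(** * Archimedean quadratic modules and their characters *)

Section QuadraticModules.
Context {R : realType} {A : comNzRingType} (c : {rmorphism R -> A}).
Implicit Types (M N : set A) (a b p x y : A).

Definition quadratic_module M :=
  [/\ M 1, forall x y, M x -> M y -> M (x + y)
    & forall a x, M x -> M (a ^+ 2 * x)].

Definition bounded_in M a := exists2 k : R, 0 < k & M (c k - a) /\ M (c k + a).

Definition archimedean_module M := forall a, bounded_in M a.

(* Plays the role of the sums of squares: it is a semiring between them and [M]. *)
Definition multipliers M : set A := [set s | forall x, M x -> M (s * x)].

(** Given the two morphism laws, [cancel c phi] makes [phi] unital and [R]-linear. *)
Definition nonneg_character M (phi : A -> R) :=
  [/\ {morph phi : x y / x + y}, {morph phi : x y / x * y},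
      cancel c phi & forall x, M x -> 0 <= phi x].

Section Basics.
Context (M : set A) (qM : quadratic_module M).

Lemma qm1 : M 1. Proof. by case: qM. Qed.

Lemma qmD x y : M x -> M y -> M (x + y). Proof. by case: qM => _ + _; exact. Qed.

Lemma qmM a x : M x -> M (a ^+ 2 * x). Proof. by case: qM => _ _; exact. Qed.

Lemma qm_sqr a : M (a ^+ 2).
Proof. by rewrite -[_ ^+ 2]mulr1; apply/qmM/qm1. Qed.

Lemma qm0 : M 0.
Proof. by rewrite -[0](mul0r (0 : A)) -expr2; apply: qm_sqr. Qed.

(** A nonnegative real has a square root in [R], so [c k] is a square in [A]. *)
Lemma qmZ k x : 0 <= k -> M x -> M (c k * x).
Proof. by move=> /sqr_sqrtr <- Mx; rewrite rmorphXn; apply: qmM. Qed.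

Lemma qmC k : 0 <= k -> M (c k).
Proof. by move=> k0; rewrite -[c k]mulr1; apply: qmZ => //; apply: qm1. Qed.

Lemma qm_cancel k x : 0 < k -> M (c k * x) -> M x.
Proof.
move=> k0 /(qmZ (k := k^-1)); rewrite mulrA -rmorphM mulVf ?gt_eqF//.
by rewrite rmorph1 mul1r invr_ge0; apply; apply: ltW.
Qed.

Lemma multipliers_qm s : multipliers M s -> M s.
Proof. by move=> /(_ 1 qm1); rewrite mulr1. Qed.

Lemma multipliers_sqr a : multipliers M (a ^+ 2).
Proof. by move=> x; apply: qmM. Qed.

Lemma multipliersD s u :
  multipliers M s -> multipliers M u -> multipliers M (s + u).
Proof. by move=> sM uM x Mx; rewrite mulrDl; apply: qmD; [apply: sM|apply: uM]. Qed.

Lemma multipliersM s u :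
  multipliers M s -> multipliers M u -> multipliers M (s * u).
Proof. by move=> sM uM x Mx; rewrite -mulrA; apply/sM/uM. Qed.

Lemma quadratic_module_adjoin a :
  quadratic_module [set x | exists y s, [/\ M y, multipliers M s & x = y + s * a]].
Proof.
split.
- exists 1, (0 ^+ 2); split; [exact: qm1|exact: multipliers_sqr|].
  by rewrite expr0n mul0r addr0.
- move=> _ _ [y [s [My Ms ->]]] [z [u [Mz Mu ->]]]; exists (y + z), (s + u).
  by split; [apply: qmD|apply: multipliersD|ring].
- move=> b _ [y [s [My Ms ->]]]; exists (b ^+ 2 * y), (b ^+ 2 * s).
  by split; [apply: qmM|apply: multipliersM => //; apply: multipliers_sqr|ring].
Qed.

(* [4 b = (b + 1)^2 - (b - 1)^2], so that the support is an ideal. *)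
Lemma qm_support_ideal a b : M a -> M (- a) -> M (b * a).
Proof.
move=> Ma Mna; apply: (@qm_cancel 4) => //.
rewrite (_ : _ * _ = (b + 1) ^+ 2 * a + (b - 1) ^+ 2 * - a); last by ring.
by apply: qmD; apply: qmM.
Qed.

(* [2 k (k^2 - a^2) = (k + a)^2 (k - a) + (k - a)^2 (k + a)]. *)
Lemma qm_sqr_bound k a : 0 < k ->
  M (c k - a) -> M (c k + a) -> M (c (k ^+ 2) - a ^+ 2).
Proof.
move=> k0 Mk1 Mk2; apply: (@qm_cancel (2 * k)); first by rewrite mulr_gt0.
rewrite (_ : _ * _ = (c k + a) ^+ 2 * (c k - a) + (c k - a) ^+ 2 * (c k + a)).
  by apply: qmD; apply: qmM.
by rewrite rmorphXn; ring.
Qed.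


Lemma qm_le k l a : k <= l -> M (c k + a) -> M (c l + a).
Proof.
rewrite -subr_ge0 => /qmC kl Ma.
by rewrite (_ : _ + a = c (l - k) + (c k + a)); [apply: qmD|ring].
Qed.

Lemma bounded_inC k : bounded_in M (c k).
Proof.
have kE := ler_norm k; have kN : - k <= `|k| by rewrite -normrN ler_norm.
exists (`|k| + 1); first by rewrite ltr_wpDl.
by rewrite -rmorphB -rmorphD; split; apply: qmC; lra.
Qed.

Lemma bounded_inD a b : bounded_in M a -> bounded_in M b -> bounded_in M (a + b).
Proof.
move=> [k k0 [ka1 ka2]] [l l0 [lb1 lb2]]; exists (k + l); first exact: addr_gt0.
split.
  by rewrite (_ : _ - _ = (c k - a) + (c l - b)); [apply: qmD|ring].
by rewrite (_ : _ + (a + b) = (c k + a) + (c l + b)); [apply: qmD|ring].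
Qed.

Lemma bounded_inZ k a : 0 < k -> bounded_in M a -> bounded_in M (c k * a).
Proof.
move=> k0 [l l0 [la1 la2]]; exists (k * l); first exact: mulr_gt0.
by rewrite rmorphM -mulrBr -mulrDr; split; apply: qmZ => //; apply: ltW.
Qed.

Lemma bounded_inN a : bounded_in M a -> bounded_in M (- a).
Proof. by move=> [k k0 [ka1 ka2]]; exists k => //; rewrite opprK. Qed.

Lemma bounded_in_sqr a : bounded_in M a -> bounded_in M (a ^+ 2).
Proof.
move=> [k k0 [ka1 ka2]]; exists (k ^+ 2); first by rewrite exprn_gt0.
split; first exact: qm_sqr_bound.
by apply: qmD; [apply/qmC/sqr_ge0|apply: qm_sqr].
Qed.

(* [4 (k + 1 + a) = 4 (k - a^2) + (2 a + 1)^2 + 3]. *)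
Lemma bounded_in_of_sqr k a : M (c k - a ^+ 2) -> bounded_in M a.
Proof.
have h b : M (c k - b ^+ 2) -> M (c (`|k| + 1) + b).
  move=> kb; apply: (@qm_le (k + 1)); first by rewrite lerD2r ler_norm.
  apply: (@qm_cancel 4) => //.
  rewrite (_ : _ * _ = c 4 * (c k - b ^+ 2) + ((b * 2 + 1) ^+ 2 + c 3)).
    by apply: qmD; [apply: qmZ|apply: qmD; [apply: qm_sqr|apply: qmC]].
  by ring.
move=> ka; exists (`|k| + 1); first by rewrite ltr_wpDl.
by split; apply: h; rewrite ?sqrrN.
Qed.

(** Polarization, [4 a b = (a + b)^2 - (a - b)^2], reduces products to squares. *)
Lemma bounded_inM a b : bounded_in M a -> bounded_in M b -> bounded_in M (a * b).
Proof.
move=> Ba Bb.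
rewrite (_ : a * b = c (1 / 4) * ((a + b) ^+ 2 - (a - b) ^+ 2)).
  apply/bounded_inZ/bounded_inD/bounded_inN/bounded_in_sqr/bounded_inD => //.
    by apply/bounded_in_sqr/bounded_inD.
  exact: bounded_inN.
rewrite (_ : _ - _ = c 4 * (a * b)); last by ring.
by rewrite mulrA -rmorphM mulfVK ?rmorph1 ?mul1r.
Qed.

End Basics.

(* Zorn's lemma also ranges over the empty chain, hence the empty set is allowed
   in [P] and [M `<=` N] is only required of nonempty [N]. *)
Lemma maximal_quadratic_module M : quadratic_module M -> ~ M (- 1) ->
  exists N, [/\ M `<=` N, quadratic_module N, ~ N (- 1)
    & forall a, ~ N a -> exists y s, [/\ N y, multipliers N s & - 1 = y + s * a]].
Proof.
move=> qM M1.
pose P N := [/\ forall x, N x -> M `<=` N, forall x y, N x -> N y -> N (x + y),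
  forall a x, N x -> N (a ^+ 2 * x) & ~ N (- 1)].
have [F FP Ftot|N [[NM ND NZ N1] Nmax]] := @Zorn_bigcup A P.
  split.
  - by move=> x [X FX Xx] y My; exists X => //; case: (FP _ FX) => + _ _ _; apply; eauto.
  - move=> x y [X FX Xx] [Y FY Yy].
    by case: (Ftot X Y FX FY) => XY; [exists Y|exists X] => //;
      [case: (FP _ FY)|case: (FP _ FX)] => _ + _ _; apply=> //; apply: XY.
  - by move=> a x [X FX Xx]; exists X => //; case: (FP _ FX) => _ _ + _; apply.
  - by move=> [X FX]; case: (FP _ FX).
have {}NM : M `<=` N.
  (* An empty maximal [N] is ruled out by [M], a strictly larger member of [P]. *)
  have [N0|/set0P[x /NM//]] := eqVneq N set0; exfalso.
  apply: (Nmax M); last by case: (qM) => _ MD MZ; split=> // x _.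
  by rewrite N0; split=> // M0; case: (M0 1); exact: qm1.
have qN : quadratic_module N by split=> //; exact: NM (qm1 qM).
exists N; split=> // a Na; apply: contrapT => N'1.
have [_ ND' NZ'] := quadratic_module_adjoin qN a.
have NN' x : N x -> exists y s, [/\ N y, multipliers N s & x = y + s * a].
  move=> Nx; exists x, (0 ^+ 2); split=> //; first exact: multipliers_sqr.
  by rewrite expr0n mul0r addr0.
(* The adjoined set contains [a] (take [y = 0], [s = 1]), so it is strictly larger than [N]. *)
apply: (Nmax [set x | exists y s, [/\ N y, multipliers N s & x = y + s * a]]).
  split=> // N'N; apply/Na/N'N; exists 0, (1 ^+ 2).
  by split; [exact: qm0|exact: multipliers_sqr|rewrite expr1n mul1r add0r].
by split=> // x _; exact: subset_trans NM NN'.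
Qed.

(* For [a] and [-a] outside [N], write [-1 = y + s a = z - u a]: then
   [-s = u + u y + s z] lies in [N], so that [s], and with it [s a], belongs
   to the support of [N], whence [-1] is in [N]. *)
Lemma maximal_quadratic_module_total N : quadratic_module N -> ~ N (- 1) ->
    (forall a, ~ N a ->
      exists y s, [/\ N y, multipliers N s & - 1 = y + s * a]) ->
  forall a, N a \/ N (- a).
Proof.
move=> qN N1 Nmax a; apply: contrapT => /not_orP[/Nmax[y [s [Ny Ns ys]]]].
move=> /Nmax[z [u [Nz Nu zu]]]; apply: N1; rewrite ys; apply: qmD => //.
rewrite mulrC; apply: qm_support_ideal => //; first exact: multipliers_qm.
rewrite (_ : - s = u + (u * y + s * z)); last first.
  have -> : u * y = u * (- 1 - s * a) by rewrite ys addrK.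
  by have -> : s * z = s * (- 1 - u * - a) by [rewrite zu addrK|]; ring.
by apply: qmD; [|exact: multipliers_qm|apply: qmD; [|apply: Nu|apply: Ns]].
Qed.

(** * The character of a total Archimedean module, by cuts *)

Section Character.
Context (N : set A) (qN : quadratic_module N) (N1 : ~ N (- 1)).
Context (archN : archimedean_module N) (Ntot : forall a, N a \/ N (- a)).

Let lower a := [set k : R | N (a - c k)].

Let phi a := sup (lower a).

(** If [l < k], the two memberships add up to [(k - l) (-1)] in [N], whence [-1] in [N]. *)
Let lower_upper a k l : N (a - c k) -> N (c l - a) -> k <= l.
Proof.
move=> Nk Nl; rewrite leNgt; apply/negP => lk; apply: N1.
apply: (@qm_cancel _ qN (k - l)); first by rewrite subr_gt0.
rewrite (_ : _ * _ = (a - c k) + (c l - a)); last by ring.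
exact: qmD.
Qed.

Let lower_has_sup a : has_sup (lower a).
Proof.
have [k _ [ka1 ka2]] := archN a; split.
  by exists (- k); rewrite /lower/= rmorphN opprK addrC.
by exists k => l la; apply: lower_upper la ka1.
Qed.

Let phi_ge a k : N (a - c k) -> k <= phi a.
Proof. by move=> Nk; apply: ub_le_sup => //; case: (lower_has_sup a). Qed.

Let phi_le a k : N (c k - a) -> phi a <= k.
Proof.
move=> Nk; apply: ge_sup; first by case: (lower_has_sup a).
by move=> l la; apply: lower_upper la Nk.
Qed.

Let phi_lower a (e : R) : 0 < e -> N (a - c (phi a - e)).
Proof.
move=> e0; have [k Nk ek] := sup_adherent e0 (lower_has_sup a).
rewrite addrC -rmorphN; apply: qm_le (_ : - k <= _) _ => //.
  by rewrite lerN2 ltW.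
by rewrite rmorphN addrC.
Qed.

(** Totality enters here: otherwise [phi a + e] would lie in [lower a], above its supremum. *)
Let phi_upper a (e : R) : 0 < e -> N (c (phi a + e) - a).
Proof.
move=> e0; case: (Ntot (a - c (phi a + e))); last by rewrite opprB.
by move=> /phi_ge; rewrite gerDl leNgt e0.
Qed.

(** The bracketing has slack [e] because [N] need not contain its limit points; the additive and
    scaling laws of [phi] are all checked through it. *)
Let phi_unique a (k : R) :
  (forall e, 0 < e -> N (a - c (k - e)) /\ N (c (k + e) - a)) -> phi a = k.
Proof.
move=> h; apply/eqP; rewrite eq_le; apply/andP; split; apply/ler_addgt0Pr => e e0.
  by apply: phi_le; case: (h e e0).
by rewrite -lerBlDr; apply: phi_ge; case: (h e e0).
Qed.

Let phiC : cancel c phi.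
Proof.
move=> k; apply: phi_unique => e e0; rewrite -!rmorphB; split; apply: qmC => //; lra.
Qed.

Let phiD : {morph phi : a b / a + b}.
Proof.
move=> a b; apply: phi_unique => e e0; have e20 : 0 < e / 2 by rewrite divr_gt0.
have -> : phi a + phi b - e = (phi a - e / 2) + (phi b - e / 2) by field.
have -> : phi a + phi b + e = (phi a + e / 2) + (phi b + e / 2) by field.
split.
  rewrite (_ : _ - _ = (a - c (phi a - e / 2)) + (b - c (phi b - e / 2))).
    by apply: qmD => //; apply: phi_lower.
  by rewrite rmorphD; ring.
rewrite (_ : _ - _ = (c (phi a + e / 2) - a) + (c (phi b + e / 2) - b)).
  by apply: qmD => //; apply: phi_upper.
by rewrite rmorphD; ring.
Qed.

Let phi_ge0 a : N a -> 0 <= phi a.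
Proof. by move=> Na; apply: phi_ge; rewrite rmorph0 subr0. Qed.

Let phiN : {morph phi : a / - a}.
Proof.
move=> a; apply: (addrI (phi a)); rewrite -phiD !subrr.
by rewrite -(rmorph0 c) phiC.
Qed.

Let phiZ_pos k a : 0 < k -> phi (c k * a) = k * phi a.
Proof.
move=> k0; apply: phi_unique => e e0; have ek0 : 0 < e / k by rewrite divr_gt0.
have -> : k * phi a - e = k * (phi a - e / k) by field; rewrite gt_eqF.
have -> : k * phi a + e = k * (phi a + e / k) by field; rewrite gt_eqF.
rewrite !rmorphM -!mulrBr; split; apply: qmZ => //; try exact: ltW.
  exact: phi_lower.
exact: phi_upper.
Qed.

Let phiZ k a : phi (c k * a) = k * phi a.
Proof.
have [k0|k0|->] := ltgtP k 0; last by rewrite rmorph0 !mul0r -(rmorph0 c) phiC.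
  have -> : c k * a = c (- k) * - a by ring.
  by rewrite phiZ_pos ?oppr_gt0// phiN mulrNN.
exact: phiZ_pos.
Qed.

(** Both [sqrt e - a] and [sqrt e + a] lie in [N], so [qm_sqr_bound] puts [e - a^2] in [N] for every
    [e > 0]. *)
Let phi_sqr0 a : phi a = 0 -> phi (a ^+ 2) = 0.
Proof.
move=> a0; apply/eqP; rewrite eq_le (phi_ge0 (qm_sqr qN a)) andbT.
apply/ler_addgt0Pr => e e0; rewrite add0r -(sqr_sqrtr (ltW e0)).
have se0 : 0 < Num.sqrt e by rewrite sqrtr_gt0.
have := phi_lower a se0; have := phi_upper a se0; rewrite a0 add0r sub0r.
rewrite rmorphN opprK => Nl Nu; apply: phi_le; apply: qm_sqr_bound => //.
by rewrite addrC.
Qed.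

(** Subtracting [c (phi a)] from [a] reduces to the case of value zero; [phiM] then follows by
    polarization. *)
Let phi_sqr a : phi (a ^+ 2) = phi a ^+ 2.
Proof.
have a0 : phi (a - c (phi a)) = 0 by rewrite phiD phiN phiC subrr.
rewrite (_ : a ^+ 2 = (a - c (phi a)) ^+ 2 + (c (2 * phi a) * a - c (phi a ^+ 2))).
  by rewrite phiD (phi_sqr0 a0) phiD phiN phiZ phiC; ring.
by rewrite rmorphXn; ring.
Qed.

Let phiM : {morph phi : a b / a * b}.
Proof.
move=> a b; apply: (@mulfI _ 2) => //.
rewrite -phiZ (_ : c 2 * _ = (a + b) ^+ 2 - (a ^+ 2 + b ^+ 2)); last by ring.
by rewrite phiD phiN phiD !phi_sqr phiD; ring.
Qed.

Lemma character_of_total_module : exists psi, nonneg_character N psi.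
Proof. by exists phi; split. Qed.

End Character.

(** * Abstract Positivstellensatz *)

Lemma character_of_proper_module M :
  quadratic_module M -> archimedean_module M -> ~ M (- 1) ->
  exists phi, nonneg_character M phi.
Proof.
move=> qM archM M1; have [N [MN qN N1 Nmax]] := maximal_quadratic_module qM M1.
have archN : archimedean_module N.
  by move=> a; have [k k0 [/MN ka1 /MN ka2]] := archM a; exists k.
have [phi [phiD phiM phiC phi0]] :=
  character_of_total_module qN N1 archN (maximal_quadratic_module_total qN N1 Nmax).
by exists phi; split=> // x /MN /phi0.
Qed.

(* Adjoining [-p] makes [M] improper, so [s p = 1 + y] with [s] a multiplier and
   [y] in [M]. For [k] large, [p + l] in [M] then implies [p + l - k^-2] in [M],
   because
   [k^2 (p + l - k^-2) = (k - s)^2 (p + l) + 2 k y + l s (2 k - s) + (2 k - 1 - s^2 p)]. *)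
Lemma positivstellensatz M p :
    quadratic_module M -> archimedean_module M ->
    (forall phi, nonneg_character M phi -> 0 < phi p) ->
  exists2 e : R, 0 < e & M (p - c e).
Proof.
move=> qM archM p_gt0.
have [s [y [Ms My spE]]] : exists s y, [/\ multipliers M s, M y & s * p = 1 + y].
  have qN := quadratic_module_adjoin qM (- p).
  set N := [set x | _] in qN; have MN : M `<=` N.
    move=> x Mx; exists x, (0 ^+ 2); split=> //; first exact: multipliers_sqr.
    by rewrite expr0n mul0r addr0.
  have [[y [s [My Ms yE]]]|N1] := pselect (N (- 1)).
    exists s, y; split=> //.
    by have -> : y = - 1 - s * - p by [rewrite yE addrK|]; ring.
  (* If [N] were proper, it would have a character, nonnegative on both [M] and [-p], against
     [p_gt0]. *)
  have archN : archimedean_module N.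
    by move=> a; have [k k0 [/MN ka1 /MN ka2]] := archM a; exists k.
  have [phi [phiD phiM phiC phi0]] := character_of_proper_module qN archN N1.
  have phip : 0 < phi p by apply: p_gt0; split=> // x /MN /phi0.
  have : 0 <= phi (- p).
    apply: phi0; exists 0, (1 ^+ 2).
    by split; [exact: qm0|exact: multipliers_sqr|rewrite expr1n mul1r add0r].
  have : phi (- p) + phi p = 0 by rewrite -phiD addNr -(rmorph0 c) phiC.
  lra.
have [k k0 [Mks Mksp]] : exists2 k : R, 0 < k & M (c (2 * k) - s) /\
    M (c (2 * k) - 1 - s ^+ 2 * p).
  have [k1 k10 [sk1 _]] := archM s.
  have [k2 k20 [spk2 _]] := archM (1 + s ^+ 2 * p).
  exists (k1 + k2); first exact: addr_gt0.
  split; first by apply: qm_le sk1 => //; lra.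
  by rewrite -addrA -opprD; apply: qm_le spk2 => //; lra.
have step (l : R) : 0 <= l -> M (p + c l) -> M (p + c (l - (k ^- 2))).
  move=> l0 Mpl; apply: (@qm_cancel _ qM (k ^+ 2)); first by rewrite exprn_gt0.
  have kk : c (k ^+ 2) * c (k ^- 2) = 1.
    by rewrite -rmorphM divff ?rmorph1// expf_neq0// gt_eqF.
  rewrite (_ : _ * _ = (c k - s) ^+ 2 * (p + c l) + (c (2 * k) * y +
     (c l * (s * (c (2 * k) - s)) + (c (2 * k) - 1 - s ^+ 2 * p)))).
    apply: qmD => //; first exact: qmM.
    apply: qmD => //; first by apply: qmZ => //; lra.
    apply: qmD => //; apply: qmZ => //.
    exact: Ms.
  have -> : y = s * p - 1 by rewrite spE addrC addKr.
  by rewrite rmorphB mulrDr mulrBr kk !rmorphXn; ring.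
have [k1 k10 [_ Mk1]] := archM p.
have [j Mj] : exists j : nat, M (p + c (j%:R * k ^- 2)).
  exists (Num.truncn (k1 * k ^+ 2)).+1; rewrite addrC; apply: qm_le Mk1 => //.
  rewrite -ler_pdivrMr ?invr_gt0 ?exprn_gt0// invrK ltW//.
  by rewrite truncnS_gt.
(* Each [step] lowers the constant by [k^-2]; once [p] itself is in [M], one more step gives
   [e = k^-2]. *)
elim: j Mj => [|j IH] Mj.
  exists (k ^- 2); first by rewrite invr_gt0 exprn_gt0.
  by have := step 0 (lexx 0); rewrite sub0r rmorphN; apply; rewrite mul0r in Mj.
apply: IH; rewrite (_ : _ * _ = j.+1%:R * k ^- 2 - k ^- 2); last first.
  by rewrite -natr1; ring.
by apply: step => //; rewrite mulr_ge0// invr_ge0 exprn_ge0// ltW.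
Qed.

End QuadraticModules.

(** * Putinar's theorem and truncated quadratic modules *)

Section PolynomialModules.
Context {R : realType} {n r : nat} (g : 'I_r -> {mpoly R[n]}).
Implicit Types (p q : {mpoly R[n]}).

Lemma sos0 : @sos R n 0.
Proof. by exists [::]; rewrite big_nil. Qed.

Lemma sosD p q : sos p -> sos q -> sos (p + q).
Proof. by move=> [s ->] [u ->]; exists (s ++ u); rewrite big_cat. Qed.

Lemma sosM p q : sos p -> sos (q ^+ 2 * p).
Proof.
move=> [s ->]; exists [seq q * x | x <- s].
by rewrite big_map mulr_sumr; apply: eq_bigr => x _; rewrite exprMn.
Qed.

Lemma qmodule_quadratic : quadratic_module (qmodule g).
Proof.
split.
- exists 1, (fun=> 0); split; last by rewrite big1 ?addr0// => k _; rewrite mul0r.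
    by exists [:: 1]; rewrite big_seq1 expr1n.
  by move=> k; apply: sos0.
- move=> _ _ [s0 [s [hs0 hs ->]]] [u0 [u [hu0 hu ->]]].
  exists (s0 + u0), (fun k => s k + u k); split; first exact: sosD.
    by move=> k; apply: sosD.
  rewrite addrACA -big_split/=; congr (_ + _).
  by apply: eq_bigr => k _; rewrite mulrDl.
- move=> q _ [s0 [s [hs0 hs ->]]].
  exists (q ^+ 2 * s0), (fun k => q ^+ 2 * s k); split; first exact: sosM.
    by move=> k; apply: sosM.
  rewrite mulrDr mulr_sumr; congr (_ + _).
  by apply: eq_bigr => k _; rewrite mulrA.
Qed.

Lemma qmodule_gen k : qmodule g (g k).
Proof.
exists 0, (fun l => (k == l)%:R); split; first exact: sos0.
  move=> l; case: eqP => _; last exact: sos0.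
  by exists [:: 1]; rewrite big_seq1 expr1n.
rewrite add0r (bigD1 k)//= eqxx mul1r big1 ?addr0// => l /negPf lk.
by rewrite eq_sym lk mul0r.
Qed.

(** Bounded elements contain the constants and are closed under sums and products, so it is enough
    to bound the variables. *)
Lemma qmodule_archimedean :
  archimedean g -> archimedean_module (@mpolyC n R) (qmodule g).
Proof.
have qM := qmodule_quadratic.
move=> [rho _ grho].
have bX k : bounded_in (@mpolyC n R) (qmodule g) (mpolyX R (mnm1 k)).
  apply: (@bounded_in_of_sqr _ _ _ _ qM (rho ^+ 2)).
  move: grho; rewrite (bigD1 k)//= opprD addrA => grho.
  (* Adding back the squares of the other variables leaves [rho^2 - X_k^2] in the module. *)
  rewrite -[X in qmodule g X](subrK (\sum_(i < n | i != k) mpolyX R (mnm1 i) ^+ 2)).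
  apply: qmD => //; apply: big_ind => [||i _]; first exact: qm0.
    by move=> x y; apply: qmD.
  exact: qm_sqr.
elim/mpolyind => [|k a p _ _ IH].
  by rewrite -(rmorph0 (@mpolyC n R)); apply: bounded_inC.
apply: bounded_inD => //; rewrite -mul_mpolyC.
apply: bounded_inM => //; first exact: bounded_inC.
rewrite mpolyXE_id; apply: big_ind => [||i _].
- by rewrite -(rmorph1 (@mpolyC n R)); apply: bounded_inC.
- by move=> x y; apply: bounded_inM.
elim: (a i) => [|d IHd].
  by rewrite expr0 -(rmorph1 (@mpolyC n R)); apply: bounded_inC.
by rewrite exprS; apply: bounded_inM.
Qed.

(** Characters are points: a morphism fixing the constants is determined by its values on the
    variables. *)
Lemma character_peval phi : nonneg_character (@mpolyC n R) (qmodule g) phi ->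
  forall p, phi p = peval p (\row_k phi (mpolyX R (mnm1 k))).
Proof.
move=> [phiD phiM phiC _]; set x := \row_k _.
have phi1 : phi 1 = 1 by rewrite -(rmorph1 (@mpolyC n R)) phiC.
elim/mpolyind => [|k a p _ _ IH].
  by rewrite /peval meval0 -(rmorph0 (@mpolyC n R)) phiC.
rewrite phiD IH /peval mevalD mevalZ; congr (_ + _).
rewrite -mul_mpolyC phiM phiC; congr (_ * _).
rewrite mevalX mpolyXE_id (big_morph phi phiM phi1); apply: eq_bigr => i _.
rewrite mxE; elim: (a i) => [|d IHd]; first by rewrite !expr0.
by rewrite !exprS phiM IHd.
Qed.

(** Each [g k] lies in the module, so the point attached to a character belongs to the semialgebraic
    set, where [p] is positive. *)
Lemma putinar p : archimedean g ->
    (forall x, basic_semialg g x -> 0 < peval p x) ->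
  exists2 e : R, 0 < e & qmodule g (p - mpolyC n e).
Proof.
move=> /qmodule_archimedean archg p_gt0.
apply: (positivstellensatz qmodule_quadratic archg) => phi hphi.
rewrite (character_peval hphi); apply: p_gt0 => k.
rewrite -(character_peval hphi); case: hphi => _ _ _; apply.
exact: qmodule_gen.
Qed.

Lemma sos_trunc_near p : sos p -> exists d, forall l, (d <= l)%N -> sos_trunc l p.
Proof.
(* Truncation at [l] bounds the squared polynomials by degree [l./2], hence the doubling. *)
move=> [s ->]; exists (\max_(q <- s) mpdeg q).*2 => l dl; exists s => //.
apply/allP => q qs; rewrite -(doubleK (mpdeg q)); apply: half_leq.
by apply: leq_trans dl; rewrite leq_double; apply: leq_bigmax_seq.
Qed.

Lemma qmodule_trunc_near q :
  qmodule g q -> \forall l \near \oo, qmodule_trunc g l q.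
Proof.
move=> [s0 [s [/sos_trunc_near[d0 hd0] hs ->]]].
have /choice[d hd] k := sos_trunc_near (hs k).
(* Beyond this level no generator is omitted and each [s k] fits the level [l - mpdeg (g k)]. *)
exists (maxn d0 (\max_k (d k + mpdeg (g k)))) => // l /=.
rewrite geq_max => /andP[/hd0 hs0 dl].
have dgl k : (d k + mpdeg (g k) <= l)%N.
  by apply: leq_trans dl; apply: (leq_bigmax k).
exists s0, s; split=> //.
  by move=> k _; apply: hd; rewrite leq_subRL ?(leq_trans _ (dgl k)) ?leq_addl// addnC.
congr (_ + _); apply: eq_bigl => k; rewrite (leq_trans _ (dgl k))//.
exact: leq_addl.
Qed.

Lemma qmodule_trunc_sub l : qmodule_trunc g l `<=` qmodule g.
Proof.
have sosT d p : sos_trunc d p -> sos p by move=> [s _ ->]; exists s.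
move=> _ [s0 [s [/sosT hs0 hs ->]]].
(* The weight of an omitted generator is arbitrary, not known to be a sum of squares; it is replaced
   by 0. *)
exists s0, (fun k => if (mpdeg (g k) <= l)%N then s k else 0); split=> // [k|].
  by case: ifP => [/hs/sosT//|_]; apply: sos0.
rewrite big_mkcond; congr (_ + _); apply: eq_bigr => k _.
by case: ifP => //; rewrite mul0r.
Qed.

End PolynomialModules.

(** * Convergence along ultrafilters and pointwise limits *)

Section Limits.

(** If the preimage of a neighbourhood is not in [F], some ultrafilter finer than [F] contains its
    complement. *)
Lemma cvg_of_ultra (T : Type) (X : topologicalType) (F : set_system T)
    (f : T -> X) (x : X) : Filter F ->
  (forall U, UltraFilter U -> F `<=` U -> f @ U --> x) -> f @ F --> x.
Proof.
move=> FF ultra_cvg A Ax; apply: contrapT => nFA.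
have PG : ProperFilter (within (~` (f @^-1` A)) F).
  split; last exact: within_filter.
  by move=> F0; apply: nFA; apply: (filterS (F := F) _ F0) => t /contrapT.
have [U [UU FU]] := ultraFilterLemma PG.
have : U (f @^-1` A).
  apply: (ultra_cvg U UU _ A Ax) => B FB; apply: FU.
  by apply: (filterS (F := F) _ FB).
have : U (~` (f @^-1` A)) by apply: FU; apply: (filterE (F := F)).
by move=> nUA UA; apply: (@filter_not_empty _ U); rewrite -(setICl (f @^-1` A)); apply: filterI.
Qed.

Lemma ultra_fmap (T T' : Type) (f : T -> T') (U : set_system T) :
  UltraFilter U -> UltraFilter (f @ U).
Proof.
move=> UU; split=> [|G GG fUG]; first exact: fmap_proper_filter.
apply/seteqP; split=> // A GA.
have [//|nUA] := in_ultra_setVsetC (f @^-1` A) UU.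
have GnA : G (~` A) by apply: fUG.
by case: (filter_not_empty G); rewrite -(setICr A); apply: filterI.
Qed.

Lemma bounded_ultra_cvg (R : realType) (T : Type) (U : set_system T)
    (f : T -> R) (M : R) : UltraFilter U ->
  (\forall t \near U, `|f t| <= M) -> exists x : R, f t @[t --> U] --> x.
Proof.
move=> UU fM; have := @segment_compact R (- M) M; rewrite compact_ultra.
have fUU : UltraFilter (f @ U) by exact: ultra_fmap.
move=> /(_ (f @ U) fUU)[|x [_ fx]]; last by exists x.
by apply: filterS fM => t /=; rewrite in_itv/= ler_norml.
Qed.

(** Linearity passes to the pointwise limit by uniqueness of limits in [R]. *)
Lemma scalar_limit (R : realType) (V : lmodType R) (T : Type)
    (F : set_system T) (lam_ : T -> {scalar V}) : ProperFilter F ->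
    (forall v, exists x : R, lam_ t v @[t --> F] --> x) ->
  exists lam : {scalar V}, forall v, lam_ t v @[t --> F] --> lam v.
Proof.
move=> FF /choice[lam cvg_lam].
have lam_lin : scalar lam.
  move=> a u v; have auv : lam_ t (a *: u + v) @[t --> F] --> a * lam u + lam v.
    under eq_fun do rewrite linearP/=.
    by apply: cvgD => //; apply: cvgM => //; exact: cvg_cst.
  exact: (cvg_unique (@Rhausdorff R) (cvg_lam _) auv).
pose HL := GRing.isLinear.Build R V R *%R lam lam_lin.
pose lamL : {scalar V} := HB.pack lam HL.
by exists lamL.
Qed.

Lemma ptws_cvg (J : Type) (X : topologicalType) (T : Type) (F : set_system T)
    (u_ : T -> J -> X) (u : J -> X) : Filter F ->
    (forall j, u_ t j @[t --> F] --> u j) ->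
  (u_ : T -> {ptws J -> X}) @ F --> (u : {ptws J -> X}).
Proof.
move=> FF cvg_u; apply/cvg_sup => j A; rewrite nbhsE => -[_ [[C oC <-] Cu] CA].
have : nbhs (u j) C by exact: open_nbhs_nbhs.
by move=> /cvg_u; apply: (filterS (F := F)) => t; apply: CA.
Qed.

End Limits.

(** * Pairings with finitely supported sequences *)

Section FiniteSupport.
Context {R : realType} {m : nat} {n : 'I_m -> nat} {J : countType}.
Implicit Types (u v : J -> R) (h : J -> polys R n).

Lemma dotseq_fset v : finsupp_seq v -> forall u,
  dotseq u v = \sum_(j <- fset_set [set j | v j != 0]) u j * v j.
Proof.
move=> vfin u; apply: fsbigTE => j; rewrite in_fset_set// notin_setE/=.
by move=> /negP; rewrite negbK => /eqP->; rewrite mulr0.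
Qed.

Lemma pairing_dotpoly v h (lam : functionals R n) : finsupp_seq v ->
  pairing lam (dotpoly h v) = dotseq (fun j => pairing lam (h j)) v.
Proof.
move=> vfin; rewrite dotseq_fset// /pairing.
under [RHS]eq_bigr do rewrite mulr_suml; rewrite exchange_big/=.
apply: eq_bigr => i _; rewrite /dotpoly (fsbigTE (fset_set [set j | v j != 0])).
  by rewrite linear_sum; apply: eq_bigr => j _; rewrite linearZ/= mulrC.
move=> j; rewrite in_fset_set// notin_setE/=.
by move=> /negP; rewrite negbK => /eqP->; rewrite scale0r.
Qed.

Lemma Jtrunc_near h j : \forall l \near \oo, Jtrunc h l j.
Proof. by apply: filter_forall => i; exact: nbhs_infty_ge. Qed.

Lemma Jtrunc_finsupp_near h v : finsupp_seq v ->
  \forall l \near \oo, forall j, v j != 0 -> Jtrunc h l j.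
Proof.
move=> vfin.
have near_Jtrunc j : j \in fset_set [set j | v j != 0] ->
    \oo [set l | Jtrunc h l j] by move=> _; exact: Jtrunc_near.
apply: (filterS (F := \oo) _ (filter_bigI _ near_Jtrunc)) => l hl j vj.
by apply: hl; rewrite /= in_fset_set// mem_set.
Qed.

End FiniteSupport.

(** * Uniform bounds on truncated feasible functionals *)

Section Bounds.
Context {R : realType} {m : nat} {n r : 'I_m -> nat} {J : countType}.
Unset Implicit Arguments.
Context (g : forall i, 'I_(r i) -> {mpoly R[n i]}).
Set Implicit Arguments.
Context (h : J -> polys R n) (t : J -> R) (K : set (J -> R)).
Hypothesis arch : forall i, archimedean (g i).

Lemma feasible_trunc l lam :
  primal_feasible g h t K lam -> trunc_feasible g h t K l lam.
Proof.
move=> [lamL lamK]; split; last by exists (fun j => t j - pairing lam (h j)).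
by move=> i q /qmodule_trunc_sub; exact: lamL.
Qed.

(** Certificates for [k - q] and [k + q] in the quadratic module have bounded degree, so the
    threshold on [l] is uniform in [lam]. *)
Lemma trunc_bound i q : exists2 k : R, 0 <= k & \forall l \near \oo,
  forall lam, Lcone_trunc g l lam -> `|lam i q| <= k * lam i 1.
Proof.
have [k k0 [/qmodule_trunc_near kq /qmodule_trunc_near kNq]] :=
  qmodule_archimedean (@arch i) q.
exists k; first exact: ltW.
near=> l => lam lamL; rewrite ler_norml.
have lamC : lam i (mpolyC (n i) k) = k * lam i 1.
  by rewrite -[mpolyC _ k]mulr1 mul_mpolyC linearZ.
have lam1 : 0 <= lam i (mpolyC (n i) k - q) by apply: lamL; near: l.
have lam2 : 0 <= lam i (mpolyC (n i) k + q) by apply: lamL; near: l.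
by rewrite linearB lamC/= in lam1; rewrite linearD lamC/= in lam2; lra.
Unshelve. all: by end_near. Qed.

Lemma trunc_mass_bound : S_full g h K -> forall i, exists C : R,
  \forall l \near \oo, forall lam, trunc_feasible g h t K l lam -> lam i 1 <= C.
Proof.
move=> [w [wfin Kw] b_gt0] i; set b := dotpoly h w in b_gt0.
have /choice[e he] k : exists e : R, 0 < e /\ qmodule (g k) (b k - mpolyC (n k) e).
  by have [e ? ?] := putinar (@arch k) (b_gt0 k); exists e.
exists (dotseq t w / e i); near=> l => lam [lamL [u Ku /funeqP uE]].
have lam1 k : 0 <= lam k 1.
  apply: lamL; move: k; near: l; apply: filter_forall => k; apply: qmodule_trunc_near.
  exact: (qm1 (qmodule_quadratic _)).
have lamb k : e k * lam k 1 <= lam k (b k).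
  rewrite -subr_ge0 -linearZ -linearB/= -mul_mpolyC mulr1; apply: lamL.
  move: k; near: l; apply: filter_forall => k; apply: qmodule_trunc_near.
  by case: (he k).
(* [u] matches [t - <lam, h>] only on [Jtrunc h l], which contains the support of [w] for large
   [l]. *)
have : dotseq u w = dotseq t w - pairing lam b.
  rewrite pairing_dotpoly// !dotseq_fset// -sumrB big_seq [RHS]big_seq.
  apply: eq_bigr => j; rewrite in_fset_set// => /set_mem wj.
  have Jj : Jtrunc h l j by move: j wj; near: l; exact: Jtrunc_finsupp_near.
  rewrite -mulrBl; congr (_ * _).
  by have := uE (SigSub (mem_set Jj)).
move: (Kw _ Ku) => /[swap] ->; rewrite subr_ge0 => lamt.
rewrite ler_pdivlMr; last by case: (he i).
(* Every block contributes nonnegatively to [<lam, b>], so block [i] alone is bounded by [t . w]. *)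
rewrite mulrC; apply: le_trans lamt; rewrite /pairing (bigD1 i)//=.
apply: ler_wpDr => //; apply: sumr_ge0 => k _.
by apply: le_trans (lamb k); rewrite mulr_ge0// ltW//; case: (he k).
Unshelve. all: by end_near. Qed.

End Bounds.

(** * Convergence of the truncated optimizers *)

Theorem theorem2p13 (R : realType) (m : nat) (m_gt0 : (0 < m)%N)
  (n r : 'I_m -> nat) (g : forall i, 'I_(r i) -> {mpoly R[n i]})
  (S_compact : forall i, compact (basic_semialg (g i)))
  (J : countType) (f : polys R n) (h : J -> polys R n) (t : J -> R)
  (K : set (J -> R))
  (K_closed : closed (K : set {ptws J -> R}))
  (K_cone : convex_cone K)
  (K_nonneg : forall u, K u -> forall j, 0 <= u j)
  (feasible : measure_feasible g h t K)
  (fullness : S_full g h K)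
  (dual_attained :
     exists v, is_maximizer (dual_feasible g f h K) (dotseq t) v)
  (arch : forall i, archimedean (g i))
  (mu : functionals R n)
  (mu_min : is_minimizer (primal_feasible g h t K)
              (fun lam => pairing lam f) mu)
  (mu_uniq : forall lam : functionals R n,
     is_minimizer (primal_feasible g h t K) (fun lam => pairing lam f) lam ->
     forall i, lam i =1 mu i)
  (lams : nat -> functionals R n)
  (lams_opt : \forall l \near \oo, canonical_optimizer g f h t K l (lams l)) :
  forall p : polys R n,
    pairing (lams l) p @[l --> \oo] --> pairing mu p.
Proof.
move=> p; apply: cvg_of_ultra => U UU ooU.
have opt : \forall l \near U, canonical_optimizer g f h t K l (lams l) by apply: ooU.
have cvg_lams i q : exists x : R, lams l i q @[l --> U] --> x.
  have [C hC] := trunc_mass_bound t arch fullness i.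
  have [k k0 hk] := trunc_bound arch q.
  apply: (@bounded_ultra_cvg _ _ _ _ (k * C)); near=> l.
  have [[lF _] _] : canonical_optimizer g f h t K l (lams l) by near: l.
  apply: (@le_trans _ _ (k * lams l i 1)).
    by case: lF => lL _; move: (lams l) lL; near: l; apply: ooU.
  by apply: ler_wpM2l => //; move: (lams l) lF; near: l; apply: ooU.
pose lam i := projT1 (cid (scalar_limit (@ultra_proper _ _ UU) (cvg_lams i))).
have lamP i q : lams l i q @[l --> U] --> lam i q by rewrite /lam; case: cid.
have pairingP q : pairing (lams l) q @[l --> U] --> pairing lam q.
  by apply: cvg_big => [|i _]; [exact: add_continuous|exact: lamP].
have lam_le : pairing lam f <= pairing mu f.
  apply: (ler_cvg_to (pairingP f) (cvg_cst _)); apply: filterS opt => l [[_ lmin] _].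
  by apply: lmin; apply: feasible_trunc; case: mu_min.
have lamF : primal_feasible g h t K lam.
  split=> [i q /qmodule_trunc_near gq|].
    apply: (ler_cvg_to (cvg_cst _) (lamP i q)); near=> l.
    have [[[lL _] _] _] : canonical_optimizer g f h t K l (lams l) by near: l.
    by apply: lL; near: l; apply: ooU.
  (* The truncated constraint is lifted to a point of [K]; each [j] is eventually in [Jtrunc h l],
     so these points converge coordinatewise to [t - <lam, h>]. *)
  have /choice[u_ uP] l : exists u, trunc_feasible g h t K l (lams l) ->
      K u /\ forall j, Jtrunc h l j -> u j = t j - pairing (lams l) (h j).
    have [[_ [u Ku /funeqP uE]]|//] := pselect (trunc_feasible g h t K l (lams l)).
      by exists u => _; split=> // j Jj; have := uE (SigSub (mem_set Jj)).
    (* A default value at infeasible levels, which [U] does not see. *)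
    by exists t.
  apply: (closed_cvg (u_ := u_ : nat -> {ptws J -> R}) (F := U) K K_closed).
    by apply: filterS opt => l [[lF _] _]; case: (uP l lF).
  apply: ptws_cvg => j.
  have : t j - pairing (lams l) (h j) @[l --> U] --> t j - pairing lam (h j).
    by apply: cvgB; [exact: cvg_cst|exact: pairingP].
  apply: cvg_trans; apply: near_eq_cvg; near=> l.
  have [[lF _] _] : canonical_optimizer g f h t K l (lams l) by near: l.
  by have [_ ->//] := uP l lF; near: l; apply: ooU; exact: Jtrunc_near.
(* The cost of [lam] is at most that of [mu], so [lam] is a minimizer too. *)
have lam_mu : forall i, lam i =1 mu i.
  apply: mu_uniq; split=> // y yF; apply: le_trans lam_le _.
  by case: mu_min => _; apply.
have <- : pairing lam p = pairing mu p by apply: eq_bigr => i _; rewrite lam_mu.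
exact: pairingP.
Unshelve. all: by end_near. Qed.
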